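(* Let $S$ be a conditionally completely regular semigroup. If $S$ is group-bound, then $S$ is a semilattice of Archimedean semigroups of the form $K_{J_e} = \bigcup_{f \in E(J_e)} K_f$ for $e\in E(S)$.
   Context: $\mathbb{N}$ denotes the positive integers; $E(S)$ is the set of idempotents of $S$. A semigroup $S$ is conditionally completely regular if every $\mathcal{H}$-class of $S$ consisting of regular elements contains an idempotent (equivalently, every regular $\mathcal{H}$-class is a group). $S$ is group-bound if for every $s\in S$ there is $n\ge 1$ such that $s^n$ lies in a subgroup of $S$. For $e\in E(S)$, $H_e$ denotes the largest subgroup of $S$ containing $e$, and $K_e=\{s\in S: s^n\in H_e \text{ for some } n\in\mathbb{N}\}$. $J_e$ is the $\mathcal{J}$-class of $e$ in $S$ and $E(J_e)$ is the set of idempotents of $S$ lying in $J_e$. A semigroup $A$ is Archimedean if for all $a,b\in A$ there exists $n\in\mathbb{N}$ with $a^n\in AbA$. $S$ is a semilattice of semigroups $S_\alpha$ ($\alpha\in Y$) if $Y$ is a semilattice (commutative semigroup of idempotents), $S$ is the disjoint union of its subsemigroups $S_\alpha$, and $S_\alpha S_\beta\subseteq S_{\alpha\beta}$ for all $\alpha,\beta\in Y$; here the subsemigroups $S_\alpha$ are precisely the distinct sets among the $K_{J_e}$, $e\in E(S)$. *)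

(* Defs.v *)
From mathcomp Require Import all_boot.
From mathcomp Require Import boolp classical_sets.

Set Implicit Arguments.
Unset Strict Implicit.
Unset Printing Implicit Defensive.

Local Open Scope classical_set_scope.
Local Open Scope group_scope.

Section Semigroups.
Variable S : semigroupType.
Implicit Types (a b e f s x y : S) (A G : set S).

(* s^n for n >= 1; the library's [s ^+ n] needs a unit. At n = 0 the value is
   the junk value s, so every use below asks for 0 < n. *)
Definition spow s (n : nat) : S := iterop n (fun x y => x * y) s s.

Definition idempotents : set S := [set e | e * e = e].

Definition regular a : Prop := exists x, a = a * x * a.

(* The principal ideals S^1 a, a S^1 and S^1 a S^1, with the products by the
   adjoined identity written out. *)
Definition left_ideal a : set S := [set a] `|` [set x * a | x in setT].
Definition right_ideal a : set S := [set a] `|` [set a * y | y in setT].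
Definition two_sided_ideal a : set S :=
  [set a] `|` [set x * a | x in setT] `|` [set a * y | y in setT]
  `|` [set x * a * y | x in setT & y in setT].

Definition Lclass a : set S := [set b | left_ideal b = left_ideal a].
Definition Rclass a : set S := [set b | right_ideal b = right_ideal a].
Definition Hclass a : set S := Lclass a `&` Rclass a.
Definition Jclass a : set S := [set b | two_sided_ideal b = two_sided_ideal a].

Definition conditionally_completely_regular : Prop :=
  forall a, Hclass a `<=` regular -> Hclass a `&` idempotents !=set0.

Definition subsemigroup A : Prop :=
  A !=set0 /\ forall x y, A x -> A y -> A (x * y).

Definition subgroup G : Prop :=
  subsemigroup G /\
  exists2 e, G e & forall x, G x ->
    [/\ e * x = x, x * e = x & exists2 y, G y & x * y = e /\ y * x = e].

Definition group_bound : Prop :=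
  forall s, exists2 n : nat, (0 < n)%N & exists2 G, subgroup G & G (spow s n).

(* H_e; [maximal_subgroup_largest] shows that this union is itself a subgroup
   when e is idempotent. *)
Definition maximal_subgroup e : set S :=
  \bigcup_(G in [set G | subgroup G /\ G e]) G.

Definition K_idem e : set S :=
  [set s | exists2 n : nat, (0 < n)%N & maximal_subgroup e (spow s n)].

Definition K_Jclass e : set S := \bigcup_(f in Jclass e `&` idempotents) K_idem f.

Definition archimedean A : Prop :=
  subsemigroup A /\
  forall a b, A a -> A b -> exists2 n : nat,
    (0 < n)%N & [set x * b * y | x in A & y in A] (spow a n).

Lemma maximal_subgroup_largest e : idempotents e ->
  [/\ subgroup (maximal_subgroup e), maximal_subgroup e e
    & forall G, subgroup G -> G e -> G `<=` maximal_subgroup e].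
Proof.
move=> ee.
have sub G : subgroup G -> G e -> G `<=` maximal_subgroup e.
  by move=> sG Ge x Gx; exists G.
pose U : set S := [set x | [/\ e * x = x, x * e = x &
  exists y, [/\ e * y = y, y * e = y, x * y = e & y * x = e]]].
have Ue : U e by split=> //; exists e.
have sU : subgroup U.
  split; first split; first by exists e.
    move=> x y [ex xe [x' [ex' x'e xx' x'x]]] [ey ye [y' [ey' y'e yy' y'y]]].
    split; [by rewrite mulgA ex | by rewrite -mulgA ye |].
    exists (y' * x'); split; [by rewrite mulgA ey' | by rewrite -mulgA x'e | |].
      by rewrite mulgA -[x * y * y']mulgA yy' xe.
    by rewrite mulgA -[y' * x' * x]mulgA x'x y'e.
  exists e => // x [ex xe [x' [ex' x'e xx' x'x]]]; split=> //.
  by exists x' => //; split=> //; exists x.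
have UE : maximal_subgroup e = U.
  apply/seteqP; split; last exact: sub.
  move=> x [G [[_ [u Gu uG]] Ge] Gx].
  have ue : u = e.
    have [_ eu [e' _ [ee' _]]] := uG e Ge.
    by rewrite -ee' -{1}ee -mulgA ee' eu.
  have [ux xu [x' Gx' [xx' x'x]]] := uG x Gx.
  have [ux' x'u _] := uG x' Gx'.
  by rewrite /U /= -ue; split=> //; exists x'.
by rewrite UE in sub *; split.
Qed.

End Semigroups.

Definition semilattice (Y : semigroupType) : Prop :=
  commutative (fun x y : Y => x * y) /\ idempotent_op (fun x y : Y => x * y).

Definition semilattice_of (S Y : semigroupType) (A : Y -> set S) : Prop :=
  [/\ semilattice Y,
      forall i, subsemigroup (A i),
      \bigcup_i A i = setT,
      trivIset setT A
    & forall i j x y, A i x -> A j y -> A (i * j) (x * y)].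

(* Main.v *)
Require Import Defs.
From HB Require Import structures.
From mathcomp Require Import all_boot.
From mathcomp Require Import boolp classical_sets.
Local Open Scope classical_set_scope.

(** For an idempotent g, say that g is below a when g = x a y for some x and
    y, and let [idem_below a] be the set of such g. The whole theorem
    follows from one identity,

      idem_below (a * b) = idem_below a `&` idem_below b,

    which makes [idem_below] a homomorphism onto a semilattice of sets; its
    fibres are the components of the decomposition.

    The inclusion from left to right is immediate. For the other one, let
    g = x b y = z a w with x, y, z, w absorbing g on the appropriate side, and
    put r = b y z a. Then g = x r w, and r is regular with inverse w x. Since
    regular H-classes are groups, r lies in S r^2 S
    ([regular_factors_through_square]), and r^2 = (b y z) (a b) (y z a) has a b
    as a factor; hence so has g.

    Group-boundness ties the fibres to the sets K_{J_e}. A power of a lies in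
    H_f for some idempotent f, and that power and f divide each other, so
    idem_below a = idem_below f; moreover two idempotents have the same
    [idem_below] exactly when they are J-equivalent. Hence the fibre through a
    is K_{J_f} ([K_JclassE]). Finally, a fibre is Archimedean because f is a
    multiple x b y of any b in the fibre of a, so a^n = (f x) b (y a^n), and the
    outer factors stay in the fibre: they have f as a multiple and are
    multiples of f or of a^n. *)

(** * Idempotents below an element *)

Section IdempotentsBelow.
Local Open Scope group_scope.
Set Implicit Arguments.
Unset Strict Implicit.
Variable S : semigroupType.
Implicit Types (a b e f g r s x y : S) (n : nat).

Definition idem_below a : set S :=
  [set g | g * g = g /\ exists x y, g = x * a * y].

(** An idempotent can absorb the cofactors of any factorization of itself, so
    they may be taken in gS and Sg. *)
Lemma idem_below_absorbed a g : idem_below a g ->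
  exists x y, [/\ g = x * a * y, g * x = x & y * g = y].
Proof.
move=> [gg [x [y gE]]]; exists (g * x), (y * g); split.
- have -> : g * x * a * (y * g) = g * (x * a * y) * g by rewrite !mulgA.
  by rewrite -gE !gg.
- by rewrite mulgA gg.
- by rewrite -mulgA gg.
Qed.

Lemma idem_below_trans a g f : idem_below a g -> idem_below g f ->
  idem_below a f.
Proof.
move=> [_ [x [y gE]]] [ff [z [w fE]]]; split=> //.
by exists (z * x), (y * w); rewrite fE gE !mulgA.
Qed.

Lemma idem_below_refl e : idempotents e -> idem_below e e.
Proof. by move=> ee; split=> //; exists e, e; rewrite !ee. Qed.

(** On idempotents the adjoined identity in the principal ideals is
    immaterial: e = e e e. *)
Lemma idem_below_two_sided a g : idempotents g ->
  two_sided_ideal a g -> idem_below a g.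
Proof.
move=> gg ag; split=> //.
case: ag => [[[ga|[x _ xa]]|[y _ ay]]|[x _ [y _ xay]]].
- by exists g, g; rewrite -[a]ga !gg.
- by exists x, g; rewrite xa gg.
- by exists g, y; rewrite -mulgA ay gg.
- by exists x, y.
Qed.

Lemma two_sided_ideal_sub a b x y : a = x * b * y ->
  two_sided_ideal a `<=` two_sided_ideal b.
Proof.
move=> -> c [[[->|[z _ <-]]|[w _ <-]]|[z _ [w _ <-]]]; right.
- by exists x => //; exists y.
- by exists (z * x) => //; exists y; rewrite ?mulgA.
- by exists x => //; exists (y * w); rewrite ?mulgA.
- by exists (z * x) => //; exists (y * w); rewrite ?mulgA.
Qed.

Lemma JclassE e f : idempotents e -> idempotents f ->
  Jclass e f <-> idem_below f = idem_below e.
Proof.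
move=> ee ff; split=> [J | ef].
  have fe : idem_below f e.
    by apply: idem_below_two_sided => //; rewrite J; do 3 left.
  have ef : idem_below e f.
    by apply: idem_below_two_sided => //; rewrite -J; do 3 left.
  by apply/seteqP; split=> g; apply: idem_below_trans.
have [_ [x [y fE]]] : idem_below e f by rewrite -ef; apply: idem_below_refl.
have [_ [z [w eE]]] : idem_below f e by rewrite ef; apply: idem_below_refl.
by apply/seteqP; split; [apply: two_sided_ideal_sub fE
                        |apply: two_sided_ideal_sub eE].
Qed.

Lemma subgroup_idempotent G e s : subgroup G -> idempotents e -> G e -> G s ->
  e * s = s /\ exists t, s * t = e.
Proof.
move=> [_ [u Gu uG]] ee Ge Gs.
have ue : u = e.
  have [_ eu [e' _ [ee' _]]] := uG e Ge.
  by rewrite -ee' -{1}ee -mulgA ee' eu.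
have [us _ [t _ [st _]]] := uG s Gs.
by rewrite -ue; split=> //; exists t.
Qed.

Lemma idem_below_subgroup G e s : subgroup G -> idempotents e -> G e -> G s ->
  idem_below s = idem_below e.
Proof.
move=> sG ee Ge Gs; have [es [t st]] := subgroup_idempotent sG ee Ge Gs.
apply/seteqP; split=> g [gg [x [y gE]]]; split=> //.
  by exists x, (s * y); rewrite gE -{1}es !mulgA.
by exists x, (t * y); rewrite gE -st !mulgA.
Qed.

(** Regularity spreads over the L-class of r, so the H-class of r is a regular
    one and contains an idempotent h; then h is an identity for r and a right
    multiple of r, say h = r v, whence r = h (r r) v. *)
Lemma regular_factors_through_square r :
  conditionally_completely_regular S -> regular r ->
  exists x y, r = x * (r * r) * y.
Proof.
move=> ccr [s rE].
have regH : Hclass r `<=` @regular S.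
  move=> b [Lb _].
  have : left_ideal b r by rewrite Lb; left.
  have : left_ideal r b by rewrite -Lb; left.
  case=> [->|[v _ vr]]; first by exists s.
  case=> [<-|[u _ ub]]; first by exists s.
  exists (s * u); have -> : b * (s * u) * b = b * s * (u * b) by rewrite !mulgA.
  by rewrite ub -vr {1}rE !mulgA.
have [h [[Lh Rh] hh]] := ccr r regH.
have rh : r * h = r.
  have : left_ideal h r by rewrite Lh; left.
  by case=> [->|[z _ <-]] //; rewrite -mulgA hh.
have hr : h * r = r.
  have : right_ideal h r by rewrite Rh; left.
  by case=> [->|[z _ <-]] //; rewrite mulgA hh.
have : right_ideal r h by rewrite -Rh; left.
case=> [hE|[v _ rv]].
  by exists r, r; rewrite -hE !hh.
by exists h, v; rewrite mulgA hr -mulgA rv rh.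
Qed.

Lemma idem_belowM a b : conditionally_completely_regular S ->
  idem_below (a * b) = idem_below a `&` idem_below b.
Proof.
move=> ccr; apply/seteqP; split=> [g [gg [x [y gE]]] | g [ag bg]].
  split; split=> //; first by exists x, (b * y); rewrite gE !mulgA.
  by exists (x * a), y; rewrite gE !mulgA.
have gg : g * g = g by case: ag.
have [z [w [gzaw gz wg]]] := idem_below_absorbed ag.
have [x [y [gxby gx yg]]] := idem_below_absorbed bg.
(* The factor a of r is on the right and b on the left, so that the product
   a b appears in the middle of r * r. *)
pose r := b * y * (z * a).
have grE : g = x * r * w.
  by rewrite /r -{1}gg {1}gxby gzaw !mulgA.
have regr : regular r.
  exists (w * x).
  have -> : r * (w * x) * r = b * y * (z * a * w) * (x * b * y) * (z * a).
    by rewrite /r !mulgA.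
  by rewrite -gzaw -gxby -(mulgA b) yg -(mulgA b) yg.
have [p [q rE]] := regular_factors_through_square ccr regr.
split=> //; exists (x * p * (b * y * z)), (y * z * a * q * w).
by rewrite grE rE /r !mulgA.
Qed.

Lemma idem_below_spow a n : conditionally_completely_regular S ->
  (0 < n)%N -> idem_below (spow a n) = idem_below a.
Proof.
move=> ccr; case: n => // n _; elim: n => // n IHn.
have -> : spow a n.+2 = a * spow a n.+1 by [].
by rewrite idem_belowM // IHn setIid.
Qed.

Lemma group_bound_idem a : group_bound S ->
  exists2 f, idempotents f & K_idem f a.
Proof.
move=> /(_ a)[n n0 [G sG Gan]].
have [_ [f Gf fG]] := sG; exists f; first by have [] := fG f Gf.
by exists n => //; exists G.
Qed.

Lemma idem_below_K_idem f a : conditionally_completely_regular S ->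
  idempotents f -> K_idem f a -> idem_below a = idem_below f.
Proof.
move=> ccr ff [n n0 fan]; rewrite -(@idem_below_spow a n ccr n0).
have [sH Hf _] := maximal_subgroup_largest ff.
exact: idem_below_subgroup sH ff Hf fan.
Qed.

Lemma K_JclassE e : conditionally_completely_regular S -> group_bound S ->
  idempotents e -> K_Jclass e = [set a | idem_below a = idem_below e].
Proof.
move=> ccr gb ee; apply/seteqP; split=> a.
  move=> [f [Jf ff] fa] /=; rewrite (@idem_below_K_idem f) //.
  exact/JclassE.
move=> /= ae; have [f ff fa] := @group_bound_idem a gb.
by exists f => //; split=> //; apply/JclassE; rewrite // -(@idem_below_K_idem f a).
Qed.

Lemma archimedean_fibre c : conditionally_completely_regular S ->
  group_bound S -> archimedean [set a | idem_below a = idem_below c].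
Proof.
move=> ccr gb; split.
  split; first by exists c.
  by move=> x y /= xc yc; rewrite idem_belowM // xc yc setIid.
move=> a b /= ac bc.
have [f ff fa] := @group_bound_idem a gb.
have fc : idem_below f = idem_below c by rewrite -(@idem_below_K_idem f a).
have bf : idem_below b f by rewrite bc -fc; apply: idem_below_refl.
have [x [y [fE fx yf]]] := idem_below_absorbed bf.
have [n n0 fan] := fa.
have anc : idem_below (spow a n) = idem_below c by rewrite idem_below_spow.
have [sH Hf _] := maximal_subgroup_largest ff.
have [fan1 _] := subgroup_idempotent sH ff Hf fan.
have xc : idem_below (f * x) = idem_below c.
  rewrite idem_belowM // fc; apply/setIidPl; rewrite -fc => g.
  apply: idem_below_trans; split=> //; exists f, (b * y).
  by rewrite fx mulgA.
have yc : idem_below (y * spow a n) = idem_below c.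
  rewrite idem_belowM // anc setIC; apply/setIidPl; rewrite -fc => g.
  apply: idem_below_trans; split=> //; exists (x * b), f.
  by rewrite -mulgA yf.
exists n => //; exists (f * x) => //; exists (y * spow a n) => //.
by rewrite fx mulgA -fE.
Qed.

End IdempotentsBelow.

(** * Homomorphisms to the semilattice of sets under intersection *)

Section IntersectionSemilattice.
Local Open Scope group_scope.
Set Implicit Arguments.
Unset Strict Implicit.
Variables (S : semigroupType) (T : Type) (h : S -> set T).
Variable hM : forall a b, h (a * b) = h a `&` h b.

(** The index semilattice is the image of h rather than a quotient of S: its
    elements are the classes themselves, and the semilattice laws are those of
    intersection. *)
Local Notation image_set := {A : set T | `[< range h A >]}.

Definition to_image (a : S) : image_set :=
  exist _ (h a) (asboolT (imageT h a)).

Lemma image_set_meet_closed (i j : image_set) :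
  `[< range h (sval i `&` sval j) >].
Proof.
case: i j => [A /asboolP[a _ aA]] [B /asboolP[b _ bB]] /=; rewrite -aA -bB.
by apply/asboolP; exists (a * b).
Qed.

Definition image_meet (i j : image_set) : image_set :=
  exist _ (sval i `&` sval j) (image_set_meet_closed i j).

Lemma image_meetA : associative image_meet.
Proof. by move=> i j k; apply: val_inj; rewrite /= setIA. Qed.

Definition image_semigroup : semigroupType :=
  HB.pack image_set (isSemigroup.Build image_set image_meetA).

Lemma image_semigroupP (i : image_semigroup) : exists a, h a = sval i.
Proof. by have /asboolP[a _ aE] := svalP i; exists a. Qed.

Lemma image_semilattice : semilattice image_semigroup.
Proof.
split=> [i j | i]; apply: val_inj; first exact: setIC.
exact: setIid.
Qed.

Lemma semilattice_of_fibres :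
  semilattice_of (fun i : image_semigroup => [set a | h a = sval i]).
Proof.
have hE (i j : image_semigroup) x y :
  h x = sval i -> h y = sval j -> h (x * y) = sval (i * j).
  by move=> xi yj; rewrite hM xi yj.
split=> //; first exact: image_semilattice.
- move=> i; split; first exact: image_semigroupP.
  move=> x y /= xi yi; rewrite (hE i i) //.
  by have [_ ->] := image_semilattice.
- by apply/seteqP; split=> // a _; exists (to_image a).
- by move=> i j _ _ [a [/= ai aj]]; apply: val_inj; rewrite /= -ai -aj.
Qed.

End IntersectionSemilattice.

Theorem theorem3p11 (S : semigroupType)
    (S_ccr : conditionally_completely_regular S) (S_gb : group_bound S) :
  exists (Y : semigroupType) (A : Y -> set S),
    [/\ semilattice_of A,
        forall i, archimedean (A i)
      & range A = [set K_Jclass e | e in @idempotents S]].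
Proof.
pose hM a b := @idem_belowM S a b S_ccr.
exists (image_semigroup hM), (fun i => [set a | idem_below a = sval i]); split.
- exact: semilattice_of_fibres.
- by move=> i; have [c ci] := image_semigroupP i; rewrite -ci; exact: archimedean_fibre.
apply/seteqP; split=> K [].
  move=> i _ <-; have [c ci] := image_semigroupP i; rewrite -ci.
  have [f ff fc] := group_bound_idem c S_gb.
  by exists f; rewrite // K_JclassE // (idem_below_K_idem S_ccr ff fc).
move=> e ee <-; exists (to_image (@idem_below S) e) => //.
by rewrite K_JclassE.
Qed.
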